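(* Let $\overline{p}=(p_i)_{i\geq 1}$ be a sequence in $]0,1]$ and let $S$ be the transition operator of the stochastic Fibonacci adding machine associated to $\overline{p}$, acting on $l^\infty(\mathbb{N})$. Then the point spectrum of $S$ is $$\sigma_{pt}(S)=\{\lambda\in\mathbb{C}:(q_n(\lambda))_{n\geq 0}\text{ is bounded}\}.$$
   Context: $\mathbb{N}=\{0,1,2,\ldots\}$. Fibonacci numbers: $F_0=1$, $F_1=2$, $F_n=F_{n-1}+F_{n-2}$ for $n\geq 2$. Every $N\in\mathbb{N}$ has a unique Fibonacci expansion $N=\sum_{i\geq 0}\varepsilon_i(N)F_i$ with $\varepsilon_i(N)\in\{0,1\}$, finitely many nonzero digits, and no two consecutive digits both equal to $1$. $[x]$ denotes the integer part of $x$. Stochastic Fibonacci adding machine: let $\overline{p}=(p_i)_{i\geq 1}\subset\,]0,1]$. It is the Markov chain on $\mathbb{N}$ whose one-step transition from a state $N$ with digits $\varepsilon_i=\varepsilon_i(N)$ is as follows. Draw independent random variables $(e_i)_{i\geq 0}$ with $e_i=1$ with probability $p_{i+1}$ and $e_i=0$ with probability $1-p_{i+1}$ (drawn afresh at each step). Put $c_{-1}=1$. The new state is $N'=\sum_i\varepsilon'_iF_i$, where: (a) if $\varepsilon_0=0$, then for all $i\geq 0$: $\varepsilon'_{2i}=\left[\frac{\varepsilon_{2i}+e_ic_{i-1}}{e_i\varepsilon_{2i+1}c_{i-1}+1}\right]$, $\varepsilon'_{2i+1}=\left[\frac{\varepsilon_{2i+1}}{e_ic_{i-1}+1}\right]$,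 $c_i=e_ic_{i-1}\varepsilon_{2i+1}$; (b) if $\varepsilon_0=1$, then $\varepsilon'_0=\left[\frac{1}{e_0+1}\right]$, $c_0=e_0$, and for all $i\geq 1$: $\varepsilon'_{2i-1}=\left[\frac{\varepsilon_{2i-1}+e_ic_{i-1}}{e_i\varepsilon_{2i}c_{i-1}+1}\right]$, $\varepsilon'_{2i}=\left[\frac{\varepsilon_{2i}}{e_ic_{i-1}+1}\right]$, $c_i=e_ic_{i-1}\varepsilon_{2i}$. $S=(S_{i,j})_{i,j\geq 0}$ is the transition matrix ($S_{i,j}$ is the one-step probability of moving from $i$ to $j$), acting on bounded complex sequences by $(Sv)_i=\sum_{j\geq 0}S_{i,j}v_j$. The point spectrum $\sigma_{pt}(S)$ is the set of $\lambda\in\mathbb{C}$ such that $S-\lambda I$ is not one-to-one on $l^\infty(\mathbb{N})$. The sequence $(q_n(\lambda))$: put $r_n=p_{\left[\frac{n+1}{2}\right]+1}$ for $n\geq 1$, $q_{F_0}(\lambda)=\frac{\lambda-(1-p_1)}{p_1}$, $q_{F_1}(\lambda)=\frac{1}{p_2}q_{F_0}(\lambda)^2-\left(\frac{1}{p_2}-1\right)$, $q_{F_n}(\lambda)=\frac{1}{r_n}q_{F_{n-1}}(\lambda)q_{F_{n-2}}(\lambda)-\left(\frac{1}{r_n}-1\right)$ for $n\geq 2$; and for $n=\sum_{i=0}^{M}\varepsilon_iF_i$ in Fibonacci expansion, $q_n(\lambda)=q_{F_0}(\lambda)^{\varepsilon_0}\cdots q_{F_M}(\lambda)^{\varepsilon_M}$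 (so $q_0(\lambda)=1$). *)

(* Defs.v *)
From HB Require Import structures.
From mathcomp Require Import all_boot all_order all_algebra.
From mathcomp Require Import finmap.
From mathcomp Require Import all_classical all_reals all_analysis.
From mathcomp Require Import complex.

Set Implicit Arguments.
Unset Strict Implicit.
Unset Printing Implicit Defensive.

Import Order.TTheory GRing.Theory Num.Theory.
Import numFieldNormedType.Exports.

Local Open Scope classical_set_scope.
Local Open Scope complex_scope.
Local Open Scope ring_scope.

(* Fibonacci numbers with the shifted initial values 1, 2 *)
Fixpoint fib (n : nat) : nat :=
  match n with
  | 0 => 1
  | m.+1 => if m is k.+1 then fib m + fib k else 2
  end%N.
Arguments fib : simpl never.

(* \sum_(i >= 0) d_i F_i for a digit sequence with finite support (and 0 for
   other digit sequences) *)
Definition fib_sum (d : nat -> nat) : nat :=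
  \big[addn/0%N]_(i \in [set: nat]) (d i * fib i)%N.

Definition fib_expansion (N : nat) (eps : nat -> bool) : Prop :=
  [/\ finite_set [set i | eps i],
      forall i, ~~ (eps i && eps i.+1)
    & N = fib_sum eps].

(* The unique Fibonacci expansion of N, see fib_digitsP and fib_digits_uniq *)
Definition fib_digits (N : nat) : nat -> bool :=
  xget (fun=> false) (fib_expansion N).

(* carry0 eps e i (when eps 0 = 0) and carry1 eps e i (when eps 0 = 1) are
   c_{i-1}, with e_i the i-th draw; the shift accommodates c_{-1} = 1. *)
Fixpoint carry0 (eps e : nat -> bool) (i : nat) : nat :=
  (if i is j.+1 then e j * carry0 eps e j * eps (2 * j).+1 else 1)%N.

Fixpoint carry1 (eps e : nat -> bool) (i : nat) : nat :=
  match i with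
  | 0 => 1
  | j.+1 => if j is _.+1 then e j * carry1 eps e j * eps (2 * j) else e 0
  end%N.

(* k-th digit of the new state when eps 0 = 0: k is 2i or 2i+1 with i = k./2 *)
Definition next_digit0 (eps e : nat -> bool) (k : nat) : nat :=
  (let i := k./2 in
   let c := carry0 eps e i in
   if odd k then eps k %/ (e i * c + 1)
   else (eps k + e i * c) %/ (e i * eps k.+1 * c + 1))%N.

(* k-th digit of the new state when eps 0 = 1: for k > 0, k is 2i-1 or 2i with
   i = uphalf k *)
Definition next_digit1 (eps e : nat -> bool) (k : nat) : nat :=
  (let i := uphalf k in
   let c := carry1 eps e i in
   if k == 0 then 1 %/ (e 0 + 1)
   else if odd k then (eps k + e i * c) %/ (e i * eps k.+1 * c + 1)
   else eps k %/ (e i * c + 1))%N.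

Definition next_state (N : nat) (e : nat -> bool) : nat :=
  let eps := fib_digits N in
  fib_sum (if eps 0 then next_digit1 eps e else next_digit0 eps e).

Definition mutually_independent d d' (T : measurableType d)
    (T' : measurableType d') (R : realType) (P : probability T R)
    (I : choiceType) (X : I -> {RV P >-> T'}) : Prop :=
  forall (J : {fset I}) (B : I -> set T'), (forall i, measurable (B i)) ->
    P (\bigcap_(i in [set` J]) (X i @^-1` B i))
    = (\prod_(i <- J) P (X i @^-1` B i))%E.

Definition transition_matrix d (T : measurableType d) (R : realType)
    (P : probability T R) (e : nat -> {RV P >-> bool}) (i j : nat) : R :=
  fine (P [set w | next_state i (fun k => e k w) = j]).

Section Operator.
Variable R : realType.

Definition linfty : set (nat -> R[i]^o) := [set v | bounded_fun v].

Definition matrix_operator (S : nat -> nat -> R) (v : nat -> R[i]^o) :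
    nat -> R[i]^o :=
  fun i => limn (series (fun j => (S i j)%:C * v j : R[i]^o)).

Definition point_spectrum (S : nat -> nat -> R) : set R[i] :=
  [set lambda | ~ set_inj linfty
     (fun (v : nat -> R[i]^o) i => matrix_operator S v i - lambda * v i)].

Section Polynomials.
Variables (p : nat -> R) (lambda : R[i]).

(* q_{F_n}; for n >= 2 the parameter r_n is p_{[(n+1)/2]+1} *)
Fixpoint qfib (n : nat) : R[i] :=
  match n with
  | 0 => (lambda - (1 - (p 1)%:C)) / (p 1)%:C
  | m.+1 =>
    if m is k.+1 then
      let r := (p ((n + 1) %/ 2 + 1)%N)%:C in
      1 / r * (qfib m * qfib k) - (1 / r - 1)
    else 1 / (p 2)%:C * qfib m ^+ 2 - (1 / (p 2)%:C - 1)
  end.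

Definition q (n : nat) : R[i]^o :=
  \big[*%R/1]_(i \in [set: nat]) (qfib i ^+ fib_digits n i).

End Polynomials.
End Operator.

Section Zeckendorf.
Local Open Scope nat_scope.

Let nonadj (eps : nat -> bool) := forall i, ~~ (eps i && eps i.+1).

Lemma fibSS n : fib n.+2 = fib n.+1 + fib n.
Proof. by []. Qed.

Lemma fib_gt0 n : 0 < fib n.
Proof.
suff : 0 < fib n /\ 0 < fib n.+1 by case.
elim: n => // n [f0 f1]; split => //.
by rewrite fibSS addn_gt0 f1.
Qed.

Lemma ltn_fib n : n < fib n.
Proof.
suff : n < fib n /\ n.+1 < fib n.+1 by case.
elim: n => // n [f0 f1]; split => //.
by rewrite fibSS -[n.+3]addn1 leq_add// fib_gt0.
Qed.

Lemma fib_sum_bounded (d : nat -> nat) m : (forall i, m <= i -> d i = 0) ->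
  fib_sum d = \sum_(i < m) d i * fib i.
Proof.
move=> dm; rewrite /fib_sum (fsbigE (iota 0 m)) ?iota_uniq//.
- rewrite (eq_bigl xpredT); last by move=> i; rewrite in_setT.
  by rewrite -[m in iota 0 m]subn0 -/(index_iota 0 m) big_mkord.
- by move=> i _; rewrite mem_iota add0n /= -leqNgt => /dm ->.
Qed.

Lemma finite_digits_bounded (eps : nat -> bool) : finite_set [set i | eps i] ->
  exists m, forall i, m <= i -> eps i = false.
Proof.
move=> /finite_fsetP[X EX]; exists (\max_(i <- X) i).+1 => i iM.
apply/negP => ei; have iX : i \in X.
  by have : [set j | eps j] i := ei; rewrite EX.
move: iM; rewrite ltnNge => /negP; apply.
exact: (leq_bigmax_seq i iX).
Qed.

Lemma fib_sum_lt eps m : nonadj eps -> \sum_(i < m) eps i * fib i < fib m.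
Proof.
move=> na.
suff : \sum_(i < m) eps i * fib i < fib m /\
       \sum_(i < m.+1) eps i * fib i < fib m.+1 by case.
elim: m => [|m [IH0 IH1]].
  by rewrite big_ord_recr/= big_ord0; case: (eps 0).
split => //; rewrite fibSS !big_ord_recr/= in IH1 *.
move: (na m) IH1.
case: (eps m.+1); case: (eps m) => //= _; rewrite ?mul0n ?mul1n ?addn0 => IH1.
- by rewrite addnC ltn_add2l.
- by rewrite (leq_trans IH1)// leq_addr.
- by rewrite (leq_trans IH1)// leq_addr.
Qed.

Lemma fib_expansion_ex N : exists eps, fib_expansion N eps.
Proof.
suff H m : N < fib m -> exists eps : nat -> bool,
    [/\ forall i, m <= i -> eps i = false, nonadj eps
      & N = \sum_(i < m) eps i * fib i].
  have [eps [em na NE]] := H N (ltn_fib N).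
  exists eps; split => //.
    apply: (@sub_finite_set _ _ `I_N) => // i /= ei.
    by case: ltnP => // /em; rewrite ei.
  by rewrite (@fib_sum_bounded _ N)// => i /em ->.
suff : forall m, (forall N, N < fib m -> exists eps : nat -> bool,
    [/\ forall i, m <= i -> eps i = false, nonadj eps
      & N = \sum_(i < m) eps i * fib i]) /\
  (forall N, N < fib m.+1 -> exists eps : nat -> bool,
    [/\ forall i, m.+1 <= i -> eps i = false, nonadj eps
      & N = \sum_(i < m.+1) eps i * fib i]).
  by move=> /(_ m)[+ _]; exact.
clear N; elim => [|k [IH0 IH1]].
  split=> [[|//] _|[|[|//]] _].
  - by exists (fun=> false); split => //; rewrite big_ord0.
  - by exists (fun=> false); split => //; rewrite big_ord_recr big_ord0.
  - exists (pred1 0); split => [[]//|[]//|].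
    by rewrite big_ord_recr big_ord0.
split => // N; rewrite fibSS => Nlt.
have [Nk|kN] := ltnP N (fib k.+1).
  have [eps [em na NE]] := IH1 _ Nk.
  exists eps; split => //; first by move=> i /ltnW; exact: em.
  by rewrite big_ord_recr/= em// mul0n addn0.
have /IH0[eps [em na NE]] : N - fib k.+1 < fib k.
  by rewrite ltn_subLR.
exists (fun i => (i == k.+1) || eps i); split => [i ki|i|].
- by rewrite gtn_eqF//= em// ltnW// ltnW.
- case: eqP => [->|_] /=.
    by rewrite (gtn_eqF (ltnSn _))/= em// ltnW// ltnW.
  by case: eqP => [[->]|_] /=; [rewrite em|exact: na].
- rewrite big_ord_recr/= eqxx mul1n big_ord_recr/= (ltn_eqF (ltnSn _)) em//.
  rewrite mul0n addn0 (eq_bigr (fun i : 'I_k => eps i * fib i)) -?NE ?subnK//.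
  by move=> i _; rewrite ltn_eqF// ltnS ltnW.
Qed.

Lemma fib_expansion_uniq N eps eps' :
  fib_expansion N eps -> fib_expansion N eps' -> eps = eps'.
Proof.
move=> [/finite_digits_bounded[m em] na ->].
move=> [/finite_digits_bounded[m' em'] na' E].
have b i : maxn m m' <= i -> eps i = 0 :> nat.
  by rewrite geq_max => /andP[/em ->].
have b' i : maxn m m' <= i -> eps' i = 0 :> nat.
  by rewrite geq_max => /andP[_ /em' ->].
move: E; rewrite (fib_sum_bounded b) (fib_sum_bounded b') => {b b'}.
move: (maxn m m') (leq_maxl m m') (leq_maxr m m') => M mM m'M E.
have {m em m' em' mM m'M} : forall i, M <= i -> eps i = eps' i.
  by move=> i Mi; rewrite em ?em'// ?(leq_trans mM) ?(leq_trans m'M).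
elim: M E => [|m IH] S E; first by apply/funext => i; exact: E.
have Em : eps m = eps' m.
  move: S; rewrite !big_ord_recr/=.
  have := fib_sum_lt m na; have := fib_sum_lt m na'.
  case: (eps m); case: (eps' m) => //; rewrite mul0n mul1n addn0 => lt lt' Q.
    by move: lt; rewrite -Q ltnNge leq_addl.
  by move: lt'; rewrite Q ltnNge leq_addl.
apply: IH => [|i].
  by move: S; rewrite !big_ord_recr/= Em => /addIn.
by rewrite leq_eqVlt => /orP[/eqP <-//|]; exact: E.
Qed.

Lemma fib_digitsP N : fib_expansion N (fib_digits N).
Proof. by have [eps] := fib_expansion_ex N; exact: xgetI. Qed.

Lemma fib_digits_uniq N eps : fib_expansion N eps -> eps = fib_digits N.
Proof. by move=> /fib_expansion_uniq; apply; exact: fib_digitsP. Qed.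

End Zeckendorf.

(* Main.v *)
Require Import Defs.
From HB Require Import structures.
From mathcomp Require Import all_boot all_order all_algebra.
From mathcomp Require Import finmap.
From mathcomp Require Import all_classical all_reals all_analysis.
From mathcomp Require Import complex.
Import Order.TTheory GRing.Theory Num.Theory.
Import numFieldNormedType.Exports.
Local Open Scope classical_set_scope.
Local Open Scope complex_scope.
Local Open Scope ring_scope.
From mathcomp Require Import zify ring.
Set Implicit Arguments.
Unset Strict Implicit.

(** The eigenvalue equation of this chain is a recurrence with a
one-dimensional space of solutions, spanned by the sequence [q].

Let [m] be the first position at which the expansion of [N] has two
consecutive zeros.  Below [m] the digits alternate and end with a 1 at
position [m - 1], so adding 1 to [N] clears all of them and writes a 1 at
position [m].  The machine performs this addition two digits at a time, from
the bottom, and stops at its first failure.  With [s := uphalf m] and [k]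
successes before the first failure, it clears the digits below
[2k - odd m] when [k <= s], and reaches [N.+1] when all of the [s.+1] draws
[e_0, .., e_s] succeed ([next_digits], [carried_expansion]).  By independence,
[k <= s] successes have probability [p_1 .. p_k (1 - p_(k+1))], so
[(S v)_N] is the finite sum [step_mean], whatever the sequence [v]
([matrix_operatorE]).

In [S v = lambda v], the equation at [N] expresses [v_(N+1)] by values of [v]
at states at most [N], because the coefficient [p_1 .. p_(s+1)] of [v_(N+1)]
is not zero.  Hence [v] is determined by [v_0] ([recurrence_eq0]).  The
sequence [q] is a solution ([q_recurrence]): the digits above [m] contribute
the same factor to each term, and what is left is an identity between the
[q_(F_n)] with [n <= m], which passes from [m] to [m + 2] by the recurrence
that defines [q_(F_(m+2))] ([qfib_recurrence]).  The solutions are therefore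
the multiples of [q], and since [q_0 = 1], a nonzero bounded one exists
exactly when [q] is bounded. *)

(** * Adding one to a Fibonacci expansion *)

(** For an expansion, this says that [m] is the first position with
[eps m = eps m.+1 = 0]: adjacent digits are never both 1, and up to [m] never both
0, so they alternate, and the parity of [m + i] tells which is which. *)
Definition double_zero (eps : nat -> bool) (m : nat) : Prop :=
  (forall i, (i <= m)%N -> eps i = odd (m + i)) /\ eps m.+1 = false.

Definition cleared (eps : nat -> bool) (t i : nat) : bool := (t <= i)%N && eps i.

(** The digits of the successor when the double zero is at [m]. *)
Definition carried (eps : nat -> bool) (m i : nat) : bool :=
  (i == m) || ((m < i)%N && eps i).

(** A finitely supported sequence ends with zeros, so a first double zero
exists; minimality and non-adjacency make [eps i] and [eps i.+1] opposite for
[i < m], which gives the parity formula by descent from [m]. *)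
Lemma double_zero_ex (eps : nat -> bool) :
  finite_set [set i | eps i] -> (forall i, ~~ (eps i && eps i.+1)) ->
  exists m, double_zero eps m.
Proof.
move=> /finite_digits_bounded[b bP] na.
have ex : exists m, ~~ eps m && ~~ eps m.+1 by exists b; rewrite !bP.
case: (ex_minnP ex) => m /andP[em em1] mmin; exists m; split; last exact/negbTE.
move=> i im; rewrite -(subKn im); elim: (m - i)%N (leq_subr i m) => [_|j IH jm].
  by rewrite subn0 addnn odd_double; apply/negbTE.
have jS : (m - j = (m - j.+1).+1)%N by lia.
have := IH (ltnW jm); rewrite jS addnS /= => E.
have := na (m - j.+1)%N; rewrite E.
have : ~~ (~~ eps (m - j.+1)%N && ~~ eps (m - j.+1).+1).
  by apply/negP => /mmin; lia.
by rewrite E; case: (eps _); case: (odd _).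
Qed.

Section Digits.
Local Open Scope nat_scope.

(** [F_(m-1) + F_(m-3) + .. = F_m - 1]: the reason why adding 1 clears an
alternating run and writes one digit just above it. *)
Lemma alternating_sum m : (\sum_(i < m) odd (m + i) * fib i).+1 = fib m.
Proof.
suff : (\sum_(i < m) odd (m + i) * fib i).+1 = fib m /\
  (\sum_(i < m.+1) odd (m.+1 + i) * fib i).+1 = fib m.+1 by case.
elim: m => [|m [IH0 IH1]]; first by rewrite !big_ord_recr !big_ord0.
split=> //; rewrite fibSS -IH0 2!big_ord_recr /=.
rewrite !negbK addnS /= addnn odd_double mul0n mul1n addn0 addnC -addnS.
by congr (_ + _.+1); apply: eq_bigr => i _; rewrite negbK.
Qed.

Section Step.
Variables (N m : nat).
Let eps := fib_digits N.
Hypothesis dz : double_zero eps m.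

Let fin : finite_set [set i | eps i]. Proof. by case: (fib_digitsP N). Qed.
Let nonadj i : ~~ (eps i && eps i.+1). Proof. by case: (fib_digitsP N). Qed.

Lemma cleared_expansion t : fib_expansion (fib_sum (cleared eps t)) (cleared eps t).
Proof.
split => //; first by apply: sub_finite_set fin => i /= /andP[].
move=> i; apply: contra (nonadj i).
by move=> /andP[/andP[_ ->] /andP[_ ->]].
Qed.

Lemma cleared_le t : fib_sum (cleared eps t) <= N.
Proof.
have [b bP] := finite_digits_bounded fin.
have [_ _ NE] := fib_digitsP N; rewrite [leqRHS]NE.
have cb i : b <= i -> cleared eps t i = 0 :> nat by move=> /bP E; rewrite /cleared E andbF.
have nb i : b <= i -> eps i = 0 :> nat by move=> /bP ->.
rewrite (fib_sum_bounded cb) (fib_sum_bounded nb).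
by apply: leq_sum => i _; rewrite leq_mul2r /cleared; case: (t <= i); rewrite ?leqnn ?orbT.
Qed.

Lemma carried_expansion : fib_expansion N.+1 (carried eps m).
Proof.
have [alt em1] := dz.
have [b bP] := finite_digits_bounded fin.
split.
- apply: (@sub_finite_set _ _ ([set m] `|` [set i | eps i])).
    by move=> i /= /orP[/eqP->|/andP[_]]; [left|right].
  by rewrite finite_setU.
- move=> i; rewrite /carried; apply/negP => /andP[/orP[/eqP->|/andP[mi ei]]].
    by rewrite em1 andbF orbF; lia.
  case/orP=> [/eqP E|/andP[_ ei']]; first by move: mi; rewrite -E; lia.
  by have := nonadj i; rewrite ei ei'.
- have [_ _ NE] := fib_digitsP N.
  have b1 i : m.+1 + b <= i -> eps i = 0 :> nat by move=> ?; rewrite bP//; lia.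
  rewrite NE (fib_sum_bounded b1) (@fib_sum_bounded _ (m.+1 + b)); last first.
    by move=> i ib; rewrite /carried bP ?andbF ?orbF; lia.
  rewrite !big_split_ord /= -addSn; congr (_ + _); last first.
    by apply: eq_bigr => i _; rewrite /carried; congr (nat_of_bool _ * _); lia.
  rewrite !big_ord_recr /= /carried eqxx mul1n alt// addnn odd_double mul0n addn0.
  rewrite [in RHS]big1 ?add0n => [|i _]; last by have := ltn_ord i; lia.
  rewrite -[RHS]alternating_sum; congr _.+1; apply: eq_bigr => i _.
  by rewrite alt// ltnW.
Qed.

End Step.

(** * The moves of the machine *)

(** The product [e_i c_(i-1)] that drives every digit is 1 exactly at the blocks
before the first failure.  Position [i.*2.+1 - odd m] is the upper digit of
block [i] for both parities: blocks are [(2i, 2i+1)] when [m] is even and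
[(2i-1, 2i)] when [m] is odd, and [odd m] is the lowest digit of the state.  The
carry dies at block [uphalf m] at the latest, since its upper digit is the zero
at position [m.+1]. *)
Lemma carry_run (eps e : nat -> bool) (c : nat -> nat) m k :
  double_zero eps m ->
  k <= (uphalf m).+1 -> (forall i, i < k -> e i) -> (k <= uphalf m -> ~~ e k) ->
  c 0 = 1 -> (forall i, c i.+1 = e i * c i * eps (i.*2.+1 - odd m)) ->
  forall i, e i * c i = (i < k).
Proof.
move=> [alt em1] ks ek nek c0 cS.
have half : (uphalf m).*2 = m + odd m by rewrite uphalf_half; lia.
have cE i : c i = ((i <= uphalf m) && (i <= k)).
  elim: i => [|i IH]; first by rewrite c0.
  rewrite cS IH; have [ik|ki|ik] := ltngtP i k.
  - rewrite (ek _ ik) mul1n; have [ilt|iu|ieq] := ltngtP i (uphalf m).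
    + rewrite alt; last by lia.
      by have -> : odd (m + (i.*2.+1 - odd m)) by lia.
    + by rewrite /= mul0n.
    + have -> : i.*2.+1 - odd m = m.+1 by lia.
      by rewrite em1.
  - by rewrite !andbF muln0 mul0n.
  - subst i; rewrite andbT andbF; case: leqP => ku; last by rewrite muln0.
    by rewrite (negbTE (nek ku)).
move=> i; rewrite cE; have [ik|ki|->] := ltngtP i k.
- by rewrite (ek _ ik); lia.
- by rewrite andbF muln0.
- by rewrite andbT; case: (leqP k) => [/nek/negbTE->|]; rewrite ?muln0.
Qed.

(** Both parities are treated together: position [j] lies in block
[b := (j + odd m)./2] and is its lower digit when [j + odd m] is even.  A block
reached by the carry is [(0, 1)] below [uphalf m], which becomes [(0, 0)], and
[(0, 0)] at [uphalf m], which becomes [(1, 0)].  For [m] odd, block 0 consists of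
its upper digit only. *)
Lemma next_digits (eps e : nat -> bool) m k : double_zero eps m ->
  k <= (uphalf m).+1 -> (forall i, i < k -> e i) -> (k <= uphalf m -> ~~ e k) ->
  (if eps 0 then next_digit1 eps e else next_digit0 eps e) =
  (if k <= uphalf m then cleared eps (k.*2 - odd m) else carried eps m).
Proof.
move=> dz ks ek nek; have run := carry_run dz ks ek nek.
have [alt em1] := dz.
have half : (uphalf m).*2 = m + odd m by rewrite uphalf_half; lia.
apply/funext => j.
have eps0 : eps 0 = odd m by rewrite alt ?addn0.
set b := (j + odd m)./2.
have jE : j + odd m = b.*2 + odd (j + odd m) by rewrite /b; lia.
have -> : (if k <= uphalf m then cleared eps (k.*2 - odd m) else carried eps m) j
   = (if k <= b then eps j else (b == uphalf m) && ~~ odd (j + odd m)).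
  case: ifP => ku; rewrite /cleared /carried; case: (leqP k b) => kb.
  - by have -> : k.*2 - odd m <= j by lia.
  - by rewrite (_ : k.*2 - odd m <= j = false); lia.
  - have -> : j == m = false by lia.
    case: (ltngtP m j) => //= mj; first lia.
    have -> : j = m.+1 by lia.
    by rewrite em1.
  - case: (ltngtP m j) => //= mj.
    + have -> : (b == uphalf m) && ~~ odd (j + odd m) = (j == m) by lia.
      have -> : j = m.+1 by lia.
      by rewrite em1; lia.
    + by lia.
    + by lia.
have lowE : b < k -> ~~ odd (j + odd m) -> eps j = false /\ eps j.+1 = (b < uphalf m).
  move=> bk lj; rewrite alt; last by lia.
  split; first by lia.
  case: (ltnP b (uphalf m)) => bu; first by rewrite alt; lia.
  by have -> : j.+1 = m.+1 by lia.
have digit_low x : x = (b < k) :> nat -> ~~ odd (j + odd m) ->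
    (eps j + x) %/ (x * eps j.+1 + 1) = (if k <= b then eps j else b == uphalf m).
  move=> -> lj; case: (ltnP b k) => bk; last by rewrite mul0n addn0 divn1.
  have [-> ->] := lowE bk lj.
  have bu : b <= uphalf m by lia.
  by case: (ltngtP b (uphalf m)) bu => // ->.
have digit_high x : x = (b < k) :> nat -> eps j %/ (x + 1) = (if k <= b then eps j else false).
  move=> ->; case: (ltnP b k) => bk; last by rewrite divn1.
  by case: (eps j).
rewrite eps0; case: ifP => om; rewrite om in half b jE lowE digit_low digit_high *.
- have bE : uphalf j = b by rewrite /b uphalf_half; lia.
  have run1 : e b * carry1 eps e b = (b < k).
    apply: run => // i; rewrite om; case: i => [|i]; last first.
      by rewrite /= mul2n; congr (_ * _ * eps _); lia.
    by rewrite /= eps0 om !muln1.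
  rewrite /next_digit1 bE; case: eqP => [j0|j0].
    have b0 : b = 0 by rewrite /b j0.
    by have := digit_high _ run1; rewrite b0 j0 eps0 om /= muln1 andbF.
  case: ifP => oj.
  - rewrite mulnAC digit_low//; last by lia.
    by rewrite addn1 /= oj andbT.
  - by rewrite digit_high// addn1 /= oj andbF.
- have run0 : e b * carry0 eps e b = (b < k).
    by apply: run => // i; rewrite om subn0 /= mul2n.
  have bE : j./2 = b by rewrite /b addn0.
  rewrite /next_digit0 bE addn0; case: ifP => oj.
  - by rewrite digit_high// andbF.
  - rewrite mulnAC digit_low//; last by rewrite addn0 oj.
    by rewrite andbT.
Qed.

End Digits.

(** * The eigenvalue recurrence *)

Section Recurrence.
Variables (R : realType) (p : nat -> R).

Definition success_prob (k : nat) : R := \prod_(j < k) p j.+1.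

(** The mean of [v] after one step from [N], when [eps] are the digits of [N]
and [double_zero eps m]: one term for each number of successes, the leading
one for [(uphalf m).+1] of them. *)
Definition step_mean (eps : nat -> bool) (N m : nat) (v : nat -> R[i]) : R[i] :=
  (success_prob (uphalf m).+1)%:C * v N.+1
  + \sum_(k < (uphalf m).+1)
      (success_prob k * (1 - p k.+1))%:C * v (fib_sum (cleared eps (k.*2 - odd m)%N)).

Lemma step_mean_linear eps N m (a : R[i]) (u v : nat -> R[i]) :
  step_mean eps N m (fun n => a * u n + v n) = a * step_mean eps N m u + step_mean eps N m v.
Proof.
rewrite /step_mean !mulrDr addrACA mulrCA; congr (_ + _).
rewrite mulr_sumr -big_split /=; apply: eq_bigr => k _.
by rewrite mulrDr mulrCA.
Qed.

Variable lambda : R[i].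
Hypothesis p_neq0 : forall i, p i.+1 != 0.

Local Notation qf := (qfib p lambda).
Local Arguments qfib : simpl never.

(** The part of [q] due to the digits in [t, m) of the alternating run below
[m]. *)
Definition alternating_prod (m t : nat) : R[i] :=
  \prod_(i < m) qf i ^+ ((t <= i)%N && odd (m + i)).

Lemma q_expansion (n b : nat) (d : nat -> bool) : fib_expansion n d ->
  (forall i, (b <= i)%N -> d i = false) ->
  q p lambda n = \prod_(i < b) qf i ^+ d i.
Proof.
move=> /fib_digits_uniq dE db; rewrite /q -dE (fsbigE (iota 0 b)) ?iota_uniq//.
- rewrite (eq_bigl xpredT); last by move=> i; rewrite in_setT.
  by rewrite -[b in iota 0 b]subn0 -/(index_iota 0 b) big_mkord.
- by move=> i _; rewrite mem_iota add0n /= -leqNgt => /db ->.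
Qed.

Lemma q0 : q p lambda 0 = 1.
Proof.
rewrite (@q_expansion 0 0 (fun=> false)) ?big_ord0//.
split=> //; first by rewrite (_ : mkset _ = set0)//; apply/seteqP; split.
by rewrite (@fib_sum_bounded _ 0)// big_ord0.
Qed.

Lemma qfibSS m :
  (p (uphalf m).+2)%:C * qf m.+2 = qf m.+1 * qf m - (1 - (p (uphalf m).+2)%:C).
Proof.
set r := p _; have -> : qf m.+2 = 1 / r%:C * (qf m.+1 * qf m) - (1 / r%:C - 1).
  rewrite /r (_ : (uphalf m).+2 = (m.+2 + 1) %/ 2 + 1)%N //.
  by rewrite uphalf_half; lia.
have : r%:C != 0 :> R[i] by rewrite fmorph_eq0 p_neq0.
by move: (r%:C) => c c0; field.
Qed.

Lemma alternating_prodSS m t : (t <= m.+1)%N ->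
  alternating_prod m.+2 t = qf m.+1 * alternating_prod m t.
Proof.
move=> tm; rewrite /alternating_prod 2!big_ord_recr /= tm.
rewrite !negbK addnS /= addnn odd_double andbF expr0 mulr1 /= expr1 mulrC.
by congr (_ * _); apply: eq_bigr => i _; rewrite !negbK.
Qed.

Lemma alternating_prod1 m : alternating_prod m m = 1.
Proof. by rewrite /alternating_prod big1// => i _; rewrite leqNgt ltn_ord. Qed.

(** The recurrence for [q] at a state without digits above [m].  From [m] to
[m.+2], the products [alternating_prod _ t] all gain the factor
[q_(F_(m+1))], and the sum gains one last term, whose product is empty; the
defining relation [qfibSS] turns this term and the new leading one into
[q_(F_(m+1))] times the old leading one. *)
Lemma qfib_recurrence m :
  (success_prob (uphalf m).+1)%:C * qf m
  + \sum_(k < (uphalf m).+1)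
      (success_prob k * (1 - p k.+1))%:C * alternating_prod m (k.*2 - odd m)
  = lambda * alternating_prod m 0.
Proof.
have p1 : (p 1)%:C != 0 :> R[i] by rewrite fmorph_eq0.
have p2 : (p 2)%:C != 0 :> R[i] by rewrite fmorph_eq0.
have qf0 : qf 0 = (lambda - (1 - (p 1)%:C)) / (p 1)%:C by [].
have qf1 : qf 1 = 1 / (p 2)%:C * qf 0 ^+ 2 - (1 / (p 2)%:C - 1) by [].
pose recurrence_at m' := (success_prob (uphalf m').+1)%:C * qf m'
  + \sum_(k < (uphalf m').+1)
      (success_prob k * (1 - p k.+1))%:C * alternating_prod m' (k.*2 - odd m')
  = lambda * alternating_prod m' 0.
suff: forall s (b : bool), recurrence_at (s.*2 + b)%N.
  by move=> /(_ m./2 (odd m)); rewrite addnC odd_double_half.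
rewrite /recurrence_at.
elim => [|s IH] b.
  rewrite /alternating_prod /success_prob; case: b => /=;
    rewrite !(big_ord_recr, big_ord0) /= !(mul1r, mulr1, expr0, expr1).
    rewrite qf1 !(rmorphM, rmorphB, rmorph1) /= qf0.
    by field; rewrite p1 p2.
  by rewrite !(rmorphM, rmorphB, rmorph1) /= qf0; field.
move: (IH b) => /=; rewrite doubleS !addSn; set m' := (s.*2 + b)%N => IHm /=.
have half : (uphalf m').*2 = (m' + odd m')%N by rewrite uphalf_half; lia.
rewrite negbK alternating_prodSS// big_ord_recr /=.
have -> : ((uphalf m').+1.*2 - odd m')%N = m'.+2 by lia.
rewrite alternating_prod1 mulr1 [RHS]mulrCA -IHm.
under eq_bigr => k _.
  rewrite alternating_prodSS; last by have := ltn_ord k; lia.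
  rewrite mulrCA; over.
rewrite -mulr_sumr [success_prob _.+2]big_ord_recr /= -/(success_prob _).
rewrite !rmorphM /= -[_ * _ * qf m'.+2]mulrA qfibSS rmorphB rmorph1 /=.
by move: (qf m'.+1) (qf m') => x y; ring.
Qed.

(** All the digits above [m] survive in every state that can be reached, so
they give a common factor [H]. *)
Lemma q_recurrence N m : double_zero (fib_digits N) m ->
  step_mean (fib_digits N) N m (q p lambda) = lambda * q p lambda N.
Proof.
move=> dz; have [fin _ _] := fib_digitsP N.
have [b bP] := finite_digits_bounded fin; have [alt _] := dz.
pose H : R[i] := \prod_(i < b) qf (m.+1 + i) ^+ fib_digits N (m.+1 + i)%N.
have qN : q p lambda N = alternating_prod m 0 * H.
  rewrite (@q_expansion _ (m.+1 + b) _ (fib_digitsP N)) => [|i ib]; last by rewrite bP; lia.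
  rewrite big_split_ord /= big_ord_recr /= alt// addnn odd_double expr0 mulr1.
  by congr (_ * _); apply: eq_bigr => i _; rewrite alt// ltnW.
have qC t : (t <= m)%N ->
    q p lambda (fib_sum (cleared (fib_digits N) t)) = alternating_prod m t * H.
  move=> tm.
  rewrite (@q_expansion _ (m.+1 + b) _ (cleared_expansion N t)) => [|i ib]; last first.
    by rewrite /cleared bP ?andbF//; lia.
  rewrite big_split_ord /= big_ord_recr /= /cleared alt// addnn odd_double andbF.
  rewrite expr0 mulr1; congr (_ * _); apply: eq_bigr => i _.
    by rewrite alt// ltnW.
  by rewrite (_ : (t <= m.+1 + i)%N)//; lia.
have qS : q p lambda N.+1 = qf m * H.
  rewrite (@q_expansion _ (m.+1 + b) _ (carried_expansion dz)) => [|i ib]; last first.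
    by rewrite /carried bP ?andbF ?orbF; lia.
  rewrite big_split_ord /= big_ord_recr /= /carried eqxx expr1 big1 => [|i _]; last first.
    by have := ltn_ord i => im; rewrite ltnNge (ltnW im) ltn_eqF.
  rewrite mul1r; congr (_ * _); apply: eq_bigr => i _.
  by rewrite gtn_eqF ?leq_addr//= ltn_addr// ltnSn.
rewrite /step_mean qN qS !mulrA -qfib_recurrence mulrDl; congr (_ + _).
rewrite mulr_suml; apply: eq_bigr => k _; rewrite qC ?mulrA//.
by have := ltn_ord k; have : (uphalf m).*2 = (m + odd m)%N; rewrite ?uphalf_half; lia.
Qed.

(** Every state reached from [N] other than [N.+1] is at most [N], so the
equation at [N] determines [w N.+1] from earlier values. *)
Lemma recurrence_eq0 (w : nat -> R[i]) :
  (forall N m, double_zero (fib_digits N) m ->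
    step_mean (fib_digits N) N m w = lambda * w N) ->
  w 0%N = 0 -> forall n, w n = 0.
Proof.
move=> rec w0; elim/ltn_ind => -[//|N] IH.
have [fin na _] := fib_digitsP N; have [m dz] := double_zero_ex fin na.
have := rec N m dz; rewrite IH// mulr0 /step_mean big1 ?addr0 => [/eqP|k _].
  rewrite mulf_eq0 fmorph_eq0 => /orP[/eqP a0|/eqP//].
  by have /negP[] : success_prob (uphalf m).+1 != 0; [apply/prodf_neq0|rewrite a0].
by rewrite IH ?mulr0// ltnS cleared_le.
Qed.

End Recurrence.

(** * The law of the number of successes *)

(** The number of successes before the first failure among the draws
[0, .., s], hence [s.+1] if none fails. *)
Definition lead (x : nat -> bool) (s : nat) : nat :=
  find (fun i => ~~ x i) (iota 0 s.+1).

Lemma lead_le x s : (lead x s <= s.+1)%N.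
Proof. by rewrite -[leqRHS](size_iota 0); apply: find_size. Qed.

Lemma lead_eqP x s k : (k <= s.+1)%N ->
  lead x s = k <-> (forall i, (i < k)%N -> x i) /\ ((k <= s)%N -> ~~ x k).
Proof.
move=> ks; split=> [<-|[xk nxk]].
  split=> [i il|ls].
    have := before_find 0%N il; rewrite nth_iota; first by rewrite add0n => /negbFE.
    exact: leq_trans il (lead_le x s).
  have h : has (fun i => ~~ x i) (iota 0 s.+1) by rewrite has_find size_iota ltnS.
  by have := nth_find 0%N h; rewrite nth_iota ?add0n// ltnS.
have [lk|kl|//] := ltngtP (lead x s) k.
  have h : has (fun i => ~~ x i) (iota 0 s.+1).
    by rewrite has_find size_iota (leq_trans lk).
  have := nth_find 0%N h; rewrite nth_iota ?add0n ?(leq_trans lk)//.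
  by rewrite xk.
have := before_find 0%N kl; rewrite nth_iota; last exact: leq_trans kl (lead_le x s).
by rewrite add0n => /negbFE xk'; have := lead_le x s; move: nxk; rewrite xk'; lia.
Qed.

Section Law.
Variables (R : realType) (p : nat -> R).
Variables (d : measure_display) (T : measurableType d) (P : probability T R).
Variable e : nat -> {RV P >-> bool}.
Hypothesis he_indep : mutually_independent e.
Hypothesis he_law : forall i : nat, P (e i @^-1` [set true]) = (p i.+1)%:E.

Let successes k := [set w | forall i, (i < k)%N -> e i w].

Let successesE k :
  successes k = \bigcap_(i in [set` [fset x in iota 0 k]%fset]) e i @^-1` [set true].
Proof.
apply/seteqP; split=> w /= H i.
  by rewrite /= !inE /= mem_iota add0n => /H.
by move=> ik; apply: H; rewrite /= !inE /= mem_iota add0n.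
Qed.

Let measurable_successes k : measurable (successes k).
Proof.
rewrite successesE; apply: fin_bigcap_measurable => // i _.
exact: measurable_funPTI.
Qed.

Lemma prob_successes k : P (successes k) = (success_prob p k)%:E.
Proof.
rewrite successesE he_indep// /success_prob -prodEFin.
under [RHS]eq_bigr do rewrite -he_law.
rewrite -(big_mkord xpredT (fun i => P (e i @^-1` [set true]))) /index_iota subn0.
apply: perm_big; apply: uniq_perm; rewrite ?iota_uniq ?fset_uniq// => x.
by rewrite !inE.
Qed.

Definition lead_prob s k : R :=
  if (k <= s)%N then success_prob p k * (1 - p k.+1) else success_prob p s.+1.

Let lead_set s k := [set w | lead (fun i => e i w) s = k].

Let lead_setE s k : (k <= s.+1)%N -> lead_set s k =
  if (k <= s)%N then successes k `\` successes k.+1 else successes s.+1.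
Proof.
move=> ks; apply/seteqP; split=> w.
  move=> /(lead_eqP _ ks)[wk nwk]; case: leqP => ks'.
    by split=> // /(_ k (ltnSn k)); apply/negP/nwk.
  by have <- : k = s.+1 by lia.
case: leqP => ks'.
  move=> [wk nwk]; apply/lead_eqP => //; split=> // _; apply/negP => ek; apply: nwk.
  move=> i; rewrite ltnS leq_eqVlt => /orP[/eqP->//|]; exact: wk.
have kE : k = s.+1 by lia.
rewrite kE => H; apply/lead_eqP => //; split=> //; lia.
Qed.

Let measurable_lead_set s k : (k <= s.+1)%N -> measurable (lead_set s k).
Proof. by move=> ks; rewrite lead_setE//; case: ifP => // _; apply: measurableD. Qed.

Let prob_lead s k : (k <= s.+1)%N -> P (lead_set s k) = (lead_prob s k)%:E.
Proof.
move=> ks; rewrite lead_setE// /lead_prob; case: ifP => _; last exact: prob_successes.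
rewrite measureD// ?(le_lt_trans (probability_le1 _ _)) ?ltry//.
rewrite (_ : _ `&` _ = successes k.+1); last first.
  by apply: setIidr => w H i ik; apply: H; rewrite ltnS ltnW.
transitivity (P (successes k) - P (successes k.+1))%E => //.
rewrite !prob_successes -EFinB; congr _%:E.
by rewrite {2}/success_prob big_ord_recr /= -/(success_prob p k); ring.
Qed.

(** The next state is a function of the number of successes alone. *)
Lemma prob_lead_image s (g : nat -> nat) j :
  P [set w | g (lead (fun i => e i w) s) = j]
  = (\sum_(k < s.+2) lead_prob s k * (g k == j)%:R)%:E.
Proof.
pose F k := if g k == j then lead_set s k else set0.
have -> : [set w | g (lead (fun i => e i w) s) = j] = \bigcup_(k in `I_s.+2) F k.
  apply/seteqP; split=> w /=.
    move=> gw; exists (lead (fun i => e i w) s); first by rewrite /= ltnS lead_le.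
    by rewrite /F gw eqxx.
  by move=> [k _]; rewrite /F; case: eqP => // gk; rewrite /lead_set /= => ->.
rewrite measure_fin_bigcup //.
- rewrite -fsbig_ord -sumEFin; apply: eq_bigr => k _; rewrite /F.
  case: eqP => _; rewrite ?mulr1 ?mulr0 ?measure0//.
  by transitivity (P (lead_set s k)) => //; rewrite prob_lead// -ltnS.
- move=> k l _ _ [w []]; rewrite /F.
  case: eqP => // _; case: eqP => // _; rewrite /lead_set /=.
  by move=> -> ->.
- by move=> k /= ks; rewrite /F; case: eqP => // _; apply: measurable_lead_set.
Qed.

(** Row [N] of the matrix has finite support, so the partial sums of the series
are eventually constant. *)
Lemma matrix_operatorE N m (v : nat -> R[i]^o) : double_zero (fib_digits N) m ->
  matrix_operator (transition_matrix e) v N = step_mean p (fib_digits N) N m v.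
Proof.
move=> dz; set s := uphalf m.
pose g k := if (k <= s)%N then fib_sum (cleared (fib_digits N) (k.*2 - odd m)) else N.+1.
have nextE w : next_state N (fun i => e i w) = g (lead (fun i => e i w) s).
  have [ek nek] := (lead_eqP _ (lead_le (fun i => e i w) s)).1 erefl.
  rewrite /next_state (@next_digits _ (fun i => e i w) _ _ dz (lead_le _ s) ek nek) /g.
  by case: leqP => //; case: (carried_expansion dz).
have SE j : transition_matrix e N j = \sum_(k < s.+2) lead_prob s k * (g k == j)%:R.
  rewrite /transition_matrix; under eq_set do rewrite nextE.
  by rewrite prob_lead_image.
have -> : step_mean p (fib_digits N) N m v = \sum_(k < s.+2) (lead_prob s k)%:C * v (g k).
  rewrite big_ord_recr /= /step_mean addrC /lead_prob /g ltnn; congr (_ + _).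
  by apply: eq_bigr => k _; rewrite -ltnS ltn_ord.
rewrite /matrix_operator; apply: norm_lim_near_cst.
exists (\max_(k < s.+2) g k).+1 => // n /= ng.
rewrite /series /=.
under eq_bigr => j _ do rewrite SE rmorph_sum mulr_suml.
rewrite exchange_big /=; apply: eq_bigr => k _.
have kn : (g k < n)%N.
  by rewrite (leq_trans _ ng)// ltnS (leq_bigmax (F := fun k : 'I_s.+2 => g k)).
rewrite (bigD1_seq (g k)) ?mem_index_iota ?iota_uniq//=.
rewrite eqxx mulr1 big1 ?addr0// => j jg.
by rewrite eq_sym (negbTE jg) mulr0 rmorph0 mul0r.
Qed.

End Law.

(** * The point spectrum *)

Theorem theorem3p3 (R : realType) (p : nat -> R)
  (hp : forall i : nat, (1 <= i)%N -> 0 < p i <= 1)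
  (d : measure_display) (T : measurableType d) (P : probability T R)
  (e : nat -> {RV P >-> bool})
  (he_indep : mutually_independent e)
  (he_law : forall i : nat, P (e i @^-1` [set true]) = (p i.+1)%:E) :
  point_spectrum (transition_matrix e)
  = [set lambda : R[i] | bounded_fun (q p lambda)].
Proof.
have p0 i : p i.+1 != 0 by case/andP: (hp i.+1 isT) => /lt0r_neq0.
have dz N : exists m, double_zero (fib_digits N) m.
  by have [fin na _] := fib_digitsP N; apply: double_zero_ex.
apply/seteqP; split=> lambda /=; last first.
  move=> qb inj; have : q p lambda = (fun=> 0).
    apply: inj; rewrite ?inE //.
      by exists 0; split=> // M M0 x _ /=; rewrite normr0 ltW.
    apply/funext => N; have [m mN] := dz N.
    rewrite !(matrix_operatorE he_indep he_law _ mN) q_recurrence// subrr.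
    rewrite /step_mean !mulr0 big1 ?addr0 ?subr0// => k _.
    by rewrite mulr0.
  by move/(congr1 (@^~ 0%N)); rewrite q0 => /eqP; rewrite oner_eq0.
move=> ninj; apply: contrapT => nqb; apply: ninj => u v.
rewrite !inE => -[Mu [Mur ub]] [Mv [Mvr vb]] E.
(* the difference of two sequences with the same image is an eigenvector *)
pose w n : R[i] := - 1 * v n + u n.
have wE N m : double_zero (fib_digits N) m ->
    step_mean p (fib_digits N) N m w = lambda * w N.
  move=> mN; have /= := congr1 (@^~ N) E.
  rewrite !(matrix_operatorE he_indep he_law _ mN) step_mean_linear !mulN1r.
  by move=> /eqP; rewrite subr_eq /w => /eqP ->; ring.
have wq n : w n = w 0%N * q p lambda n.
  apply/eqP; rewrite -subr_eq0 -mulNr addrC; apply/eqP.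
  apply: (@recurrence_eq0 _ p lambda p0 (fun n => - w 0%N * q p lambda n + w n)).
    move=> N m mN; rewrite step_mean_linear wE// q_recurrence//; ring.
  by rewrite q0; ring.
have [w0|w0] := eqVneq (w 0%N) 0.
  apply/funext => n; apply/eqP; rewrite -subr_eq0 addrC -mulN1r.
  by apply/eqP; rewrite -/(w n) wq w0 mul0r.
case: nqb; exists ((Mu + 1 + (Mv + 1)) / `|w 0%N|); split=> [|M ltM n _].
  by rewrite realM ?realV ?realD ?real1 ?normr_real.
have qE : q p lambda n = w n / w 0%N by rewrite wq mulrC mulKf.
rewrite /= qE normrM normfV; apply: le_trans (ltW ltM).
rewrite ler_pM2r ?invr_gt0 ?normr_gt0//.
rewrite addrC; apply: le_trans (ler_normD _ _) _; rewrite mulN1r normrN.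
by apply: lerD; [apply: vb|apply: ub] => //; rewrite ltrDl ltr01.
Qed.
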